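(* Let $\sigma>0$ and $\alpha\in\mathbb{R}$ be given, and consider probability densities $\varphi$ with $$S_\varphi=\Bigl[\alpha,\alpha+\frac{2\pi}{\sigma}\Bigr],\qquad ( * )$$ where $S_\varphi$ is the essential support of $\varphi$. (i) There exists a probability density $\varphi$ satisfying $( * )$ such that, for any characteristic function $g:\mathbb{R}\to\mathbb{C}$ with $\hat\varphi(t)=g(t)$ for all $t\in U_\sigma$, it follows that $\hat\varphi\equiv g$ on $\mathbb{R}$. (ii) There exist a probability density $\varphi$ satisfying $( * )$ and a characteristic function $g:\mathbb{R}\to\mathbb{C}$ such that $\hat\varphi(t)=g(t)$ for all $t\in U_\sigma$ but $\hat\varphi\not\equiv g$ on $\mathbb{R}$.
   Context: A characteristic function is the Fourier transform $\hat\mu(t)=\int_{\mathbb{R}}e^{-itx}\,d\mu(x)$, $t\in\mathbb{R}$, of a probability measure $\mu$ (Borel, on $\mathbb{R}$). A probability density is a function $\varphi\in L^1(\mathbb{R})$ with $\varphi\ge 0$ almost everywhere and $\|\varphi\|_{L^1(\mathbb{R})}=1$; $\hat\varphi(t)=\int_{\mathbb{R}}e^{-itx}\varphi(x)\,dx$ is its characteristic function. For a measurable function $\varphi:\mathbb{R}\to\mathbb{R}$, the essential support $S_\varphi$ is the set of points $x\in\mathbb{R}$ such that, for any $\varepsilon>0$, the set $(x-\varepsilon,x+\varepsilon)\cap\{t\in\mathbb{R}:|\varphi(t)|>0\}$ has positive Lebesgue measure. For $\sigma>0$, $U_\sigma=\{x\in\mathbb{R}:|x|>\sigma\}$. *)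

(* Defs.v *)
From mathcomp Require Import all_boot all_order all_algebra.
From mathcomp Require Import complex.
From mathcomp Require Import all_classical all_reals all_analysis.

Set Implicit Arguments.
Unset Strict Implicit.
Unset Printing Implicit Defensive.

Import Order.TTheory GRing.Theory Num.Theory.
Import numFieldNormedType.Exports.

Local Open Scope classical_set_scope.
Local Open Scope ring_scope.
Local Open Scope complex_scope.

(* [Rintegral] takes a junk value on non-integrable functions; the integrands
   used below are integrable: [expi] is bounded, and is integrated against a
   probability measure or multiplied by an L^1 function. *)
Definition cintegral d (T : measurableType d) (R : realType)
    (mu : {measure set T -> \bar R}) (f : T -> R[i]) : R[i] :=
  (\int[mu]_x complex.Re (f x)) +i* (\int[mu]_x complex.Im (f x)).

(* [expi y] is e^{iy}, by Euler's formula *)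
Definition expi (R : realType) (y : R) : R[i] := cos y +i* sin y.

Definition measure_fourier (R : realType)
    (mu : probability (measurableTypeR R) R) (t : R) : R[i] :=
  cintegral mu (fun x : R => expi (- (t * x))).

Definition fun_fourier (R : realType) (phi : R -> R) (t : R) : R[i] :=
  cintegral (@lebesgue_measure R) (fun x : R => expi (- (t * x)) * (phi x)%:C).

Definition is_characteristic_function (R : realType) (g : R -> R[i]) : Prop :=
  exists mu : probability (measurableTypeR R) R,
    forall t, g t = measure_fourier mu t.

Definition is_probability_density (R : realType) (phi : R -> R) : Prop :=
  [/\ phi \in Lfun (@lebesgue_measure R) 1%E,
      {ae @lebesgue_measure R, forall x : R, 0 <= phi x} &
      ('N[@lebesgue_measure R]_1 [EFin \o phi] = 1)%E].

Definition essential_support (R : realType) (phi : R -> R) : set R :=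
  [set x | forall e : R, 0 < e ->
    (0 < lebesgue_measure (`](x - e)%R, (x + e)%R[%classic
                             `&` [set t | (0 < `|phi t|)%R]))%E].

Definition outer_set (R : realType) (sigma : R) : set R :=
  [set x | sigma < `|x|].

(* Main.v *)
Require Import Defs.
From HB Require Import structures.
From mathcomp Require Import all_boot all_order all_algebra.
From mathcomp Require Import complex ring lra.
From mathcomp Require Import all_classical all_reals all_analysis measurable_realfun.
Import Order.TTheory GRing.Theory Num.Theory.
Import numFieldNormedType.Exports.

Local Open Scope classical_set_scope.
Local Open Scope ring_scope.
Local Open Scope complex_scope.

(** If the transforms of two probability measures mu and nu agree for
|t| > sigma, then mu - nu integrates to zero every trigonometric polynomial
whose frequencies all exceed sigma in absolute value. Both halves of the
statement are about how much the positivity of mu and nu adds to this.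

A determined density. Let phi be proportional to 1 - cos y on the interval,
where y = 3 sigma (x - alpha), and let K_N be the Fejer sum
|sum_(j < N) e^(i j y)|^2, which is nonnegative and has constant term N. Its
other frequencies are nonzero multiples of 3 sigma, so that multiplication by
K_N sends every frequency t of [-sigma, sigma] beyond sigma, apart from the
contribution of the constant term. Hence
  N * int cos (t x + theta) d(mu - nu) = int cos (t x + theta) K_N d(mu - nu),
and for t = 0 the left-hand side is 0, so that K_N has the same integral against
mu and nu (sub_integral_wave_fejer). By positivity the right-hand side is at
most 2 int K_N dnu. If nu has density phi this is bounded in N, because
K_N (1 - cos y) = 1 - cos (N y) <= 2 (fejer_mul_one_sub_cos). Letting N grow,
mu and nu agree at the frequency t (same_frequency_of_fejer_bound).

An undetermined density. Put q(u) = (1 + cos u) / (u^2 - pi^2), which is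
negative exactly on ]-pi, pi[, and f(x) = q(sigma (x - c)), where c is the
midpoint of the interval. The transform of f vanishes beyond sigma and at 0, but
not at sigma / 2. So the positive and negative parts of f have the same
integral; normalized to probability densities, they have transforms that agree
beyond sigma and differ at sigma / 2, and the negative part lives on the
interval.

The transform of f is computed without an inversion theorem. The function q is,
up to a factor, the difference of the translates by pi and - pi of
(1 - cos v) / v. Hence the integral of q(u) cos (s u) over [-n, n] is, up to
terms that tend to 0, a multiple of the sum of the values at n - pi and n + pi
of S(s v) - S((s + 1) v) / 2 - S((s - 1) v) / 2, where S is the sine integral
(primitive_extremal_cos). Since S has a limit L > 0 at infinity
(dirichlet_integral), this combination tends to L - L/2 - L/2 = 0 for s > 1, it
is 0 for s = 0, and for s = 1/2 it tends to L - L/2 + L/2 = L, as S is odd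
(trisinc_cvg). *)

(** * Probability measures with a density *)

(** The proof arguments let the measure structures below, which depend on them,
be attached to this constant. *)
Definition density_measure {R : realType} (p : R -> R) (p_ge0 : forall x, 0 <= p x)
    (ip : (@lebesgue_measure R).-integrable setT (EFin \o p)) :
    set (measurableTypeR R) -> \bar R :=
  fun A => (\int[@lebesgue_measure R]_(x in A) (p x)%:E)%E.

Section density.
Context {R : realType} (p : R -> R) (p_ge0 : forall x, 0 <= p x).
Context (ip : (@lebesgue_measure R).-integrable setT (EFin \o p)).
Local Notation leb := (@lebesgue_measure R).
Local Notation nu := (density_measure p p_ge0 ip).

Let nu0 : nu set0 = 0%E.
Proof. by rewrite /density_measure integral_set0. Qed.

Let nu_ge0 A : (0 <= nu A)%E.
Proof. by apply: integral_ge0 => x _; rewrite lee_fin. Qed.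

Let nu_sigma_additive : semi_sigma_additive nu.
Proof.
apply: (@semi_sigma_additive_nng_induced _ _ _ leb (EFin \o p)).
- exact: measurable_int ip.
- by move=> x; rewrite lee_fin.
Qed.

HB.instance Definition _ := isMeasure.Build _ _ _ nu nu0 nu_ge0 nu_sigma_additive.

Context (p1 : (\int[leb]_x (p x)%:E = 1)%E).

Let nu_setT : nu setT = 1%E. Proof. exact: p1. Qed.

HB.instance Definition _ := @Measure_isProbability.Build _ _ R nu nu_setT.

Lemma density_measure_dominates : nu `<< leb.
Proof.
apply/null_content_dominatesP => A mA A0.
apply: null_set_integral => //; apply: (measurable_funS measurableT) => //.
exact: (measurable_int _ ip).
Qed.

(** By uniqueness of Radon-Nikodym derivatives, that of [nu] is [p] almost
everywhere. *)
Lemma integral_density_measure (f : R -> R) : measurable_fun setT f ->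
  [bounded f x | x in setT] ->
  (\int[nu]_x (f x)%:E = \int[leb]_x (f x * p x)%:E)%E.
Proof.
move=> mf bf.
have fi : nu.-integrable setT (EFin \o f).
  apply: measurable_bounded_integrable => //.
  have n1 : (nu setT < +oo)%E by rewrite nu_setT ltry.
  exact: n1.
rewrite -(Radon_Nikodym_change_of_variables density_measure_dominates)//=.
under [RHS]eq_integral do rewrite EFinM.
have mp : measurable_fun setT p by apply/measurable_EFinP; exact: measurable_int ip.
apply: ae_eq_integral => //.
- apply: emeasurable_funM => //; first exact/measurable_EFinP.
  apply: measurable_int; apply: Radon_Nikodym_integrable.
  exact: density_measure_dominates.
- by apply: emeasurable_funM => //; exact/measurable_EFinP.
- apply: ae_eqe_mul2l => /=.
  rewrite Radon_NikodymE//=; first exact: density_measure_dominates.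
  move=> ?; case: cid => /= h [h1 h2 h3].
  apply: integral_ae_eq => //=; first exact/measurable_EFinP.
  by move=> E E01 mE; rewrite -h3.
Qed.

Lemma density_probability_exists : exists mu : probability (measurableTypeR R) R,
  forall f : R -> R, measurable_fun setT f -> [bounded f x | x in setT] ->
  \int[mu]_x f x = \int[leb]_x (f x * p x).
Proof.
exists nu => f mf bf; rewrite /Rintegral; congr fine.
exact: integral_density_measure.
Qed.

End density.

(** * Real waves and characteristic functions *)

(** With a free phase, real waves carry the same information at the frequency
[t] as e^(- i t x), and their products with cosines are again sums of waves. *)
Definition wave {R : realType} (t theta x : R) : R := cos (t * x + theta).

Definition same_frequency {R : realType}
    (mu nu : probability (measurableTypeR R) R) (t : R) :=
  forall theta, \int[mu]_x wave t theta x = \int[nu]_x wave t theta x.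

Lemma continuous_wave {R : realType} (t theta : R) : continuous (wave t theta).
Proof.
move=> x; rewrite /wave.
apply: continuous_comp; last exact: continuous_cos.
apply: cvgD; last exact: cvg_cst.
by apply: cvgM; [exact: cvg_cst|exact: cvg_id].
Qed.

Lemma measurable_wave {R : realType} (t theta : R) : measurable_fun setT (wave t theta).
Proof. by apply: continuous_measurable_fun; exact: continuous_wave. Qed.

Lemma wave_le1 {R : realType} (t theta x : R) : `|wave t theta x| <= 1.
Proof. exact: cos_max. Qed.

Lemma bounded_by {R : realType} {T : Type} (A : set T) (f : T -> R) (M : R) :
  (forall x, `|f x| <= M) -> [bounded f x | x in A].
Proof.
move=> fM; exists M; split; first by rewrite num_real.
by move=> y My x Ax /=; rewrite (le_trans (fM x))// ltW.
Qed.

Lemma integrable_prob {R : realType} (mu : probability (measurableTypeR R) R)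
    (f : R -> R) (M : R) : measurable_fun setT f -> (forall x, `|f x| <= M) ->
  mu.-integrable setT (EFin \o f).
Proof.
move=> mf fM; apply: measurable_bounded_integrable => //.
  by have := probability_setT mu; rewrite /= => ->; rewrite ltry.
exact: bounded_by fM.
Qed.

Lemma integrable_wave {R : realType} (mu : probability (measurableTypeR R) R)
    (t theta : R) :
  mu.-integrable setT (EFin \o wave t theta).
Proof.
by apply: (@integrable_prob _ mu _ 1); [exact: measurable_wave|exact: wave_le1].
Qed.

Lemma bounded_wave {R : realType} (t theta : R) :
  [bounded wave t theta x | x in [set: R]].
Proof. by apply: (bounded_by _ _ 1); exact: wave_le1. Qed.

Lemma integrable_mul_wave {R : realType} (g : R -> R) (t theta : R) :
  (@lebesgue_measure R).-integrable setT (EFin \o g) ->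
  (@lebesgue_measure R).-integrable setT (EFin \o (fun x => g x * wave t theta x)).
Proof.
move=> ig; rewrite (_ : _ \o _ = (EFin \o g) \* (EFin \o wave t theta))%E//.
by apply: integrableMl => //; [exact: measurable_wave|exact: bounded_wave].
Qed.

Lemma measure_fourierE {R : realType} (mu : probability (measurableTypeR R) R) (t : R) :
  measure_fourier mu t = (\int[mu]_x wave t 0 x) +i* (\int[mu]_x wave t (pi / 2) x).
Proof.
rewrite /measure_fourier /cintegral; congr (_ +i* _); apply: eq_Rintegral => x _ /=.
  by rewrite /wave addr0 cosN.
by rewrite /wave cosDpihalf sinN.
Qed.

Lemma waveE {R : realType} (t theta x : R) :
  wave t theta x = cos theta * wave t 0 x + sin theta * wave t (pi / 2) x.
Proof. rewrite /wave addr0 cosDpihalf cosD; ring. Qed.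

Lemma integral_wave {R : realType} (mu : probability (measurableTypeR R) R)
    (t theta : R) :
  \int[mu]_x wave t theta x =
  cos theta * \int[mu]_x wave t 0 x + sin theta * \int[mu]_x wave t (pi / 2) x.
Proof.
under eq_Rintegral do rewrite waveE.
rewrite RintegralD//; last 2 first.
- apply: (@integrable_prob _ mu _ `|cos theta|).
    by apply: measurable_funM => //; exact: measurable_wave.
  by move=> x; rewrite normrM ler_piMr// wave_le1.
- apply: (@integrable_prob _ mu _ `|sin theta|).
    by apply: measurable_funM => //; exact: measurable_wave.
  by move=> x; rewrite normrM ler_piMr// wave_le1.
by rewrite !RintegralZl//; exact: integrable_wave.
Qed.

(** By the addition formula every wave of frequency [t] is a combination of the
real and imaginary parts of the transform at [t]. *)
Lemma same_frequencyP {R : realType} (mu nu : probability (measurableTypeR R) R) (t : R) :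
  measure_fourier mu t = measure_fourier nu t <-> same_frequency mu nu t.
Proof.
rewrite !measure_fourierE; split=> [[e0 e1] theta|e].
  by rewrite integral_wave [RHS]integral_wave e0 e1.
by rewrite !e.
Qed.

Lemma probability_densityP {R : realType} (p : R -> R) : (forall x, 0 <= p x) ->
  (@lebesgue_measure R).-integrable setT (EFin \o p) ->
  (\int[@lebesgue_measure R]_x (p x)%:E = 1)%E -> is_probability_density p.
Proof.
move=> p0 ip p1; split; first exact/Lfun1_integrable.
  exact: aeW.
rewrite Lnorm1 -[RHS]p1; apply: eq_integral => x _ /=.
by rewrite ger0_norm.
Qed.

(** This turns equalities between transforms of densities into statements on
probability measures, where [same_frequencyP] applies. *)
Lemma density_law {R : realType} (p : R -> R) : (forall x, 0 <= p x) ->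
  (@lebesgue_measure R).-integrable setT (EFin \o p) ->
  (\int[@lebesgue_measure R]_x (p x)%:E = 1)%E ->
  exists mu : probability (measurableTypeR R) R,
    (forall t, fun_fourier p t = measure_fourier mu t) /\
    (forall f : R -> R, measurable_fun setT f -> [bounded f x | x in setT] ->
      \int[mu]_x f x = \int[@lebesgue_measure R]_x (f x * p x)).
Proof.
move=> p0 ip p1; have [mu muE] := density_probability_exists p p0 ip p1.
exists mu; split=> // t; rewrite measure_fourierE.
rewrite /fun_fourier /cintegral !muE; last 4 first.
- exact: measurable_wave.
- exact: bounded_wave.
- exact: measurable_wave.
- exact: bounded_wave.
congr (_ +i* _); apply: eq_Rintegral => x _; rewrite /wave /expi /=.
  by rewrite mulr0 subr0 cosN addr0.
by rewrite mulr0 add0r sinN cosDpihalf.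
Qed.

(** * Fejer sums and the recovery of low frequencies *)

(** The squared modulus of the sum of e^(i j y) over j < N, that is, [N] times
the Fejer kernel. *)
Definition fejer {R : realType} (N : nat) (y : R) : R :=
  (\sum_(j < N) cos (j%:R * y)) ^+ 2 + (\sum_(j < N) sin (j%:R * y)) ^+ 2.

Lemma fejerE {R : realType} N (y : R) :
  fejer N y = \sum_(j < N) \sum_(l < N) cos ((j%:R - l%:R) * y).
Proof.
rewrite /fejer !expr2 !mulr_suml -big_split/=; apply: eq_bigr => j _.
rewrite !mulr_sumr -big_split/=; apply: eq_bigr => l _.
by rewrite mulrBl cosB.
Qed.

(** Half of the squared modulus of (1 - e^(i y)) sum_(j < N) e^(i j y) =
1 - e^(i N y), since |1 - e^(i y)|^2 = 2 (1 - cos y). *)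
Lemma fejer_mul_one_sub_cos {R : realType} N (y : R) :
  fejer N y * (1 - cos y) = 1 - cos (N%:R * y).
Proof.
(* real and imaginary parts of the telescoping sum *)
have eA n : (1 - cos y) * (\sum_(j < n) cos (j%:R * y)) +
    sin y * (\sum_(j < n) sin (j%:R * y)) = 1 - cos (n%:R * y).
  elim: n => [|n IH]; first by rewrite !big_ord0 mul0r cos0; ring.
  by rewrite !big_ord_recr/= -[n.+1%:R]natr1 (mulrDl n%:R) mul1r cosD; lra.
have eB n : (1 - cos y) * (\sum_(j < n) sin (j%:R * y)) -
    sin y * (\sum_(j < n) cos (j%:R * y)) = - sin (n%:R * y).
  elim: n => [|n IH]; first by rewrite !big_ord0 mul0r sin0; ring.
  by rewrite !big_ord_recr/= -[n.+1%:R]natr1 (mulrDl n%:R) mul1r sinD; lra.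
have cs := cos2Dsin2 y; have csN := cos2Dsin2 (N%:R * y).
have : ((1 - cos y) ^+ 2 + sin y ^+ 2) * fejer N y =
    (1 - cos (N%:R * y)) ^+ 2 + sin (N%:R * y) ^+ 2.
  by rewrite -eA -[in RHS](opprK (sin (N%:R * y))) -eB /fejer; ring.
have -> : (1 - cos y) ^+ 2 + sin y ^+ 2 = 2 * (1 - cos y).
  by transitivity (1 - 2 * cos y + (cos y ^+ 2 + sin y ^+ 2)); [ring|rewrite cs; ring].
have -> : (1 - cos (N%:R * y)) ^+ 2 + sin (N%:R * y) ^+ 2 = 2 * (1 - cos (N%:R * y)).
  transitivity (1 - 2 * cos (N%:R * y) + (cos (N%:R * y) ^+ 2 + sin (N%:R * y) ^+ 2)).
    by ring.
  by rewrite csN; ring.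
by move=> e; lra.
Qed.

Lemma integrable_Rsum {R : realType} d (T : measurableType d)
    (mu : {measure set T -> \bar R}) (I : Type) (s : seq I) (f : I -> T -> R) :
  (forall i, mu.-integrable setT (EFin \o f i)) ->
  mu.-integrable setT (EFin \o (fun x => \sum_(i <- s) f i x)).
Proof.
move=> intf; rewrite (_ : _ \o _ = fun x => (\sum_(i <- s) (f i x)%:E)%E); last first.
  by apply/funext => x /=; rewrite sumEFin.
by apply: integrable_sum => // i _; exact: intf.
Qed.

Lemma Rintegral_sum {R : realType} d (T : measurableType d)
    (mu : {measure set T -> \bar R}) (I : Type) (s : seq I) (f : I -> T -> R) :
  (forall i, mu.-integrable setT (EFin \o f i)) ->
  \int[mu]_x (\sum_(i <- s) f i x) = \sum_(i <- s) \int[mu]_x f i x.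
Proof.
move=> intf; elim: s => [|i s IH].
  rewrite big_nil; under eq_Rintegral do rewrite big_nil.
  by rewrite Rintegral_cst// mul0r.
under eq_Rintegral do rewrite big_cons.
rewrite RintegralD//; first by rewrite big_cons IH.
exact: integrable_Rsum.
Qed.

Lemma wave_mul_cos {R : realType} (t theta omega a k x : R) :
  wave t theta x * cos (k * (omega * (x - a))) =
  2^-1 * wave (t + k * omega) (theta - k * omega * a) x +
  2^-1 * wave (t - k * omega) (theta + k * omega * a) x.
Proof.
rewrite /wave.
have -> : (t + k * omega) * x + (theta - k * omega * a) =
  (t * x + theta) + k * (omega * (x - a)) by ring.
have -> : (t - k * omega) * x + (theta + k * omega * a) =
  (t * x + theta) - k * (omega * (x - a)) by ring.
by move: (t * x + theta) => b; rewrite cosD cosB; field.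
Qed.

Lemma integral_wave_fejer {R : realType} (mu : probability (measurableTypeR R) R)
    (t theta omega a : R) (N : nat) :
  \int[mu]_x (wave t theta x * fejer N (omega * (x - a))) =
  \sum_(j < N) \sum_(l < N)
    (2^-1 * \int[mu]_x
       wave (t + (j%:R - l%:R) * omega) (theta - (j%:R - l%:R) * omega * a) x +
     2^-1 * \int[mu]_x
       wave (t - (j%:R - l%:R) * omega) (theta + (j%:R - l%:R) * omega * a) x).
Proof.
under eq_Rintegral.
  move=> x _; rewrite fejerE mulr_sumr.
  under eq_bigr.
    move=> j _; rewrite mulr_sumr.
    under eq_bigr do rewrite wave_mul_cos.
    over.
  over.
have iw s th : mu.-integrable setT (EFin \o (fun x => 2^-1 * wave s th x)).
  apply: (@integrable_prob _ mu _ 1) => [|x].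
    by apply: measurable_funM => //; exact: measurable_wave.
  have := wave_le1 s th x; rewrite !ler_norml; lra.
have iww s th s' th' : mu.-integrable setT
    (EFin \o (fun x => 2^-1 * wave s th x + 2^-1 * wave s' th' x)).
  apply: (@integrable_prob _ mu _ 1) => [|x].
    by apply: measurable_funD; apply: measurable_funM => //; exact: measurable_wave.
  have := wave_le1 s th x; have := wave_le1 s' th' x; rewrite !ler_norml; lra.
rewrite Rintegral_sum; last by move=> j; apply: integrable_Rsum => l.
apply: eq_bigr => j _; rewrite Rintegral_sum//; apply: eq_bigr => l _.
by rewrite RintegralD// !RintegralZl//; exact: integrable_wave.
Qed.

(** In the double sum that expands the product of the wave and the Fejer sum, a
term with j != l has frequencies t +- (j - l) omega, whose absolute value is at
least omega - sigma > sigma; there the two measures agree. The N terms with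
j = l remain. *)
Lemma sub_integral_wave_fejer {R : realType} (mu nu : probability (measurableTypeR R) R)
    (sigma omega t theta a : R) (N : nat) :
  (forall s, sigma < `|s| -> same_frequency mu nu s) ->
  2 * sigma < omega -> `|t| <= sigma ->
  \int[mu]_x (wave t theta x * fejer N (omega * (x - a))) -
    \int[nu]_x (wave t theta x * fejer N (omega * (x - a))) =
  N%:R * (\int[mu]_x wave t theta x - \int[nu]_x wave t theta x).
Proof.
move=> munu somega ts; rewrite !integral_wave_fejer -sumrB.
transitivity (\sum_(j < N)
    (\int[mu]_x wave t theta x - \int[nu]_x wave t theta x)); last first.
  by rewrite sumr_const card_ord mulr_natl.
apply: eq_bigr => j _; rewrite -sumrB (bigD1 j)//= big1 ?addr0.
  by rewrite subrr !mul0r !addr0 !subr0 ; field.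
move=> l lj.
have k1 : 1 <= `|j%:R - l%:R : R|.
  rewrite -[j%:R]/((j : int)%:~R) -[l%:R]/((l : int)%:~R) -intrB -intr_norm ler1z.
  by rewrite -gtz0_ge1 normr_gt0 subr_eq0 eqz_nat eq_sym.
have s0 : 0 <= sigma by rewrite (le_trans _ ts).
have far : 2 * sigma < `|(j%:R - l%:R) * omega|.
  rewrite normrM (lt_le_trans somega)// (le_trans (ler_norm _))//.
  by rewrite ler_peMl.
rewrite (munu (t + (j%:R - l%:R) * omega)); last first.
  rewrite addrC; have := lerB_normD ((j%:R - l%:R) * omega) t; lra.
rewrite (munu (t - (j%:R - l%:R) * omega)); last first.
  rewrite distrC; have := lerB_dist ((j%:R - l%:R) * omega) t; lra.
by rewrite subrr.
Qed.

Lemma fejer_ge0 {R : realType} N (y : R) : 0 <= fejer N y.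
Proof. by rewrite addr_ge0// sqr_ge0. Qed.

Lemma measurable_fejer {R : realType} N (omega a : R) :
  measurable_fun setT (fun x : R => fejer N (omega * (x - a))).
Proof.
under eq_fun do rewrite fejerE.
apply: measurable_sum => j; apply: measurable_sum => l.
set k := _ - _; rewrite (_ : (fun x : R => _) = wave (k * omega) (- (k * omega * a))).
  exact: measurable_wave.
by apply/funext => x; rewrite /wave; congr cos; ring.
Qed.

Lemma fejer_le {R : realType} N (y : R) : fejer N y <= N%:R * N%:R.
Proof.
rewrite fejerE; apply: (@le_trans _ _ (\sum_(j < N) \sum_(l < N) 1)).
  by do 2 apply: ler_sum => ? _; rewrite cos_le1.
by rewrite !sumr_const card_ord mulr_natl.
Qed.

(** The Fejer sum has the same integral against both measures (frequency 0), and
it is nonnegative, so that [N] times the difference at the frequency [t] is at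
most twice that integral, whatever [N]. *)
Lemma same_frequency_of_fejer_bound {R : realType}
    (mu nu : probability (measurableTypeR R) R) (sigma omega a C : R) :
  (forall s, sigma < `|s| -> same_frequency mu nu s) ->
  0 < sigma -> 2 * sigma < omega ->
  (forall N, \int[nu]_x fejer N (omega * (x - a)) <= C) ->
  forall t, same_frequency mu nu t.
Proof.
move=> munu sigma0 somega nuC t; have [/munu//|ts theta] := ltP sigma `|t|.
have mwfejer s th N :
    measurable_fun setT (fun x : R => wave s th x * fejer N (omega * (x - a))).
  by apply: measurable_funM; [exact: measurable_wave|exact: measurable_fejer].
have ifejer (m : probability (measurableTypeR R) R) N :
    m.-integrable setT (EFin \o (fun x => fejer N (omega * (x - a)))).
  apply: (@integrable_prob _ _ _ (N%:R * N%:R)) => [|x]; first exact: measurable_fejer.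
  by rewrite ger0_norm ?fejer_ge0 ?fejer_le.
have iwfejer (m : probability (measurableTypeR R) R) s th N :
    m.-integrable setT (EFin \o (fun x => wave s th x * fejer N (omega * (x - a)))).
  apply: (@integrable_prob _ _ _ (N%:R * N%:R)) => // x.
  rewrite normrM (ger0_norm (fejer_ge0 _ _)) (le_trans _ (fejer_le N (omega * (x - a))))//.
  by rewrite ler_piMl ?fejer_ge0 ?wave_le1.
have wfejer_le (m : probability (measurableTypeR R) R) s th N :
    `|\int[m]_x (wave s th x * fejer N (omega * (x - a)))| <=
    \int[m]_x fejer N (omega * (x - a)).
  apply: (le_trans (le_normr_Rintegral _ (iwfejer _ _ _ _))) => //.
  apply: (le_Rintegral _ (integrable_norm (iwfejer m s th N)) (ifejer m N)) => //.
  move=> x _ /=; rewrite normrM (ger0_norm (fejer_ge0 _ _)).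
  by rewrite ler_piMl ?fejer_ge0 ?wave_le1.
have mufejer N : \int[mu]_x fejer N (omega * (x - a)) =
    \int[nu]_x fejer N (omega * (x - a)).
  have := @sub_integral_wave_fejer _ mu nu sigma omega 0 0 a N munu somega.
  rewrite normr0 ltW// => /(_ isT).
  under eq_Rintegral do rewrite /wave mul0r addr0 cos0 mul1r.
  under [X in _ - X]eq_Rintegral do rewrite /wave mul0r addr0 cos0 mul1r.
  move=> /eqP; rewrite subr_eq => /eqP ->.
  under eq_Rintegral do rewrite /wave mul0r addr0 cos0.
  under [X in _ - X]eq_Rintegral do rewrite /wave mul0r addr0 cos0.
  rewrite !Rintegral_cst// (_ : fine (mu setT) = fine (nu setT)).
    by rewrite subrr mulr0 add0r.
  by congr fine; rewrite (probability_setT mu) (probability_setT nu).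
have key N : N%:R * `|\int[mu]_x wave t theta x - \int[nu]_x wave t theta x| <= 2 * C.
  rewrite -[X in X * _]ger0_norm// -normrM.
  rewrite -(@sub_integral_wave_fejer _ mu nu sigma omega t theta a N)//.
  apply: (le_trans (ler_normB _ _)).
  have := wfejer_le mu t theta N; have := wfejer_le nu t theta N.
  rewrite mufejer; have := nuC N; lra.
apply/eqP; rewrite -subr_eq0 -normr_eq0 eq_le normr_ge0 andbT leNgt; apply/negP => d0.
set d := `|_| in d0 key.
have := key (Num.truncn (2 * C / d)).+1.
apply/negP; rewrite -ltNge -ltr_pdivrMr//.
exact: truncnS_gt.
Qed.

(** * Essential supports that are intervals *)

(** The exceptional set, being countable, is null: it cannot exhaust a
subinterval. *)
Lemma essential_support_itvcc {R : realType} (a b : R) (phi : R -> R) (Z : set R) :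
  a < b -> measurable_fun setT phi ->
  (forall x, x \notin `[a, b] -> phi x = 0) ->
  countable Z -> (forall x, x \in `]a, b[ -> ~ Z x -> phi x != 0) ->
  essential_support phi = `[a, b]%classic.
Proof.
move=> ab mphi phi0 cZ phiN0; apply/seteqP; split => x /=.
  move=> supp; apply/negPn/negP => xab.
  have [e e0 eab] : exists2 e, 0 < e & forall y, x - e < y < x + e -> y \notin `[a, b].
    move: xab; rewrite in_itv/= negb_and -!ltNge => /orP[xa|bx].
      exists (a - x); first by rewrite subr_gt0.
      by move=> y ?; rewrite in_itv/= negb_and -!ltNge; apply/orP; left; lra.
    exists (x - b); first by rewrite subr_gt0.
    by move=> y ?; rewrite in_itv/= negb_and -!ltNge; apply/orP; right; lra.
  have := supp e e0; set S := (X in lebesgue_measure X).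
  rewrite (_ : S = set0) ?measure0 ?ltxx// -subset0 => y [] /=.
  rewrite in_itv/= => /eab /phi0 ->.
  by rewrite normr0 ltxx.
rewrite in_itv/= => /andP[ax xb] e e0.
have mS : measurable (`](x - e), (x + e)[%classic `&` [set t | 0 < `|phi t|]).
  apply: measurableI => //.
  rewrite (_ : [set t | _] = setT `&` phi @^-1` (~` [set 0])).
    by apply: mphi => //; exact: measurableC.
  by apply/seteqP; split=> t /=; rewrite normr_gt0; [move=> /eqP|move=> [_ /eqP]].
pose u := Num.max (x - e) a; pose v := Num.min (x + e) b.
have uv : u < v by rewrite lt_min !gt_max; lra.
have mZ : measurable Z by apply: countable_measurable cZ.
have Z0 : lebesgue_measure Z = 0%E by apply: countable_lebesgue_measure0.
apply: (@lt_le_trans _ _ (lebesgue_measure (`]u, v[%classic `\` Z))); last first.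
  apply: le_measure; rewrite ?inE//; first exact: measurableD.
  move=> y [/=]; rewrite !in_itv/= /u /v lt_min gt_max => /andP[/andP[xy ay] /andP[yx yb]] Zy.
  by split; [rewrite xy yx|rewrite normr_gt0 phiN0// in_itv/= ay yb].
have luv : lebesgue_measure (`]u, v[%classic : set R) = (v - u)%:E.
  by rewrite lebesgue_measure_itv/= lte_fin uv -EFinB.
have luv_gt0 : (0 < lebesgue_measure (`]u, v[%classic : set R))%E.
  by rewrite luv lte_fin subr_gt0.
have luv_lty : (lebesgue_measure (`]u, v[%classic : set R) < +oo)%E.
  by rewrite luv ltry.
rewrite measureD// [X in (_ - X)%E](_ : _ = 0%E) ?sube0//.
apply/eqP; rewrite eq_le measure_ge0 andbT -Z0.
by apply: le_measure; rewrite ?inE//; exact: measurableI.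
Qed.

(** * Integrals and antiderivatives of continuous functions *)

Lemma continuous_scaled_shift {R : realType} (f : R -> R) (a c : R) :
  continuous f -> continuous (fun x : R => f (a * (x - c))).
Proof.
move=> cf x; apply: (@continuous_comp _ _ _ (fun x : R => a * (x - c)) f).
  by apply: cvgM; [exact: cvg_cst|apply: cvgB; [exact: cvg_id|exact: cvg_cst]].
exact: cf.
Qed.

Lemma continuous_is_derive {R : realType} (F f : R -> R) :
  (forall x : R, is_derive x 1 F (f x)) -> continuous F.
Proof.
by move=> dF x; apply/differentiable_continuous/derivable1_diffP; exact: ex_derive.
Qed.

Lemma integral_itvcc_FTC {R : realType} (f F : R -> R) (a b : R) : a < b ->
  continuous f -> (forall x : R, is_derive x 1 F (f x)) ->
  (\int[@lebesgue_measure R]_(x in `[a, b]) (f x)%:E = (F b - F a)%:E)%E.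
Proof.
move=> ab cf dF.
have cF := continuous_is_derive _ _ dF.
rewrite (@continuous_FTC2 _ f F)//.
- exact: continuous_subspaceT.
- split.
  + by move=> x _; exact: ex_derive.
  + by apply: cvg_at_right_filter; exact: cF.
  + by apply: cvg_at_left_filter; exact: cF.
- by move=> x _; rewrite derive1E; exact: derive_val.
Qed.

Lemma continuous_integrable_itv {R : realType} (f : R -> R) (a b : R) :
  continuous f -> (@lebesgue_measure R).-integrable `[a, b] (EFin \o f).
Proof.
move=> cf; apply: continuous_compact_integrable; first exact: segment_compact.
exact: continuous_subspaceT.
Qed.

Lemma is_derive0_cst {R : realType} (D : R -> R) :
  (forall x : R, is_derive x 1 D 0) -> forall x y, D x = D y.
Proof.
move=> dD x y; wlog xy : x y / x < y.
  by move=> h; have [/h//|/h->//|->] := ltgtP x y.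
have [_ _] := MVT xy (fun z _ => dD z) (continuous_subspaceT (continuous_is_derive _ _ dD)).
by rewrite mul0r => /eqP; rewrite subr_eq0 => /eqP.
Qed.

(** The integral from 0 to [x], with its sign. On ]-M, M[ it differs by a
constant from the integral over [-M, x], to which the fundamental theorem of
calculus applies. *)
Lemma continuous_has_primitive {R : realType} (f : R -> R) : continuous f ->
  exists2 F : R -> R, F 0 = 0 & forall x : R, is_derive x 1 F (f x).
Proof.
move=> cf; have fi a b := continuous_integrable_itv f a b cf.
pose I a b := \int[@lebesgue_measure R]_(x in `[a, b]) f x.
have IB a b c : a <= b -> b <= c -> I a c - I a b = I b c.
  move=> ab bc; rewrite /I Rintegral_itvB//= ?bnd_simp//.
  apply: Rintegral_itv_obnd_cbnd; apply: integrableS (fi b c) => //.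
  exact: subset_itv_oc_cc.
pose F x := if 0 <= x then I 0 x else - I x 0.
have FE M x : - M < x -> 0 < M -> F x = I (- M) x - I (- M) 0.
  move=> Mx M0; rewrite /F; case: leP => x0; first by rewrite IB// oppr_le0 ltW.
  by rewrite -[LHS]opprK opprK -(IB (- M) x 0) ?opprB// ltW.
exists F; first by rewrite /F lexx /I set_itv1 Rintegral_set1.
move=> x; pose M := `|x| + 1.
have M0 : 0 < M by rewrite ltr_wpDl.
have Mx : - M < x < M by rewrite -ltr_norml /M ltrDl.
have [Mx1 Mx2] := andP Mx.
have [dI I'] := continuous_FTC1_closed Mx2 (fi (- M) M) Mx1 (cf x).
have -> : f x = f x - 0 by rewrite subr0.
apply: (@near_eq_is_derive _ _ _ (fun y => I (- M) y - I (- M) 0)).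
  near=> y; rewrite -FE//; near: y; exact: lt_nbhsr.
apply: is_deriveB; split; first exact: dI.
by rewrite -derive1E I'.
Unshelve. all: by end_near. Qed.

Lemma is_derive_affine {R : realType} (F f : R -> R) (a b x : R) :
  (forall y : R, is_derive y 1 F (f y)) ->
  is_derive x 1 (fun y : R => F (a * y + b)) (a * f (a * x + b)).
Proof.
move=> dF; have dg : is_derive x 1 (fun y : R => a * y + b) a.
  by apply: is_derive_eq; rewrite /GRing.scale/=; ring.
rewrite mulrC; exact: (@is_derive1_comp _ F (fun y : R => a * y + b) x _ _ (dF _) dg).
Qed.

Lemma even_primitive {R : realType} (F f : R -> R) :
  (forall y : R, is_derive y 1 F (f y)) -> (forall y, f (- y) = - f y) ->
  forall y, F (- y) = F y.
Proof.
move=> dF fN y; pose D z := F z - F (-1 * z + 0).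
have dD (z : R) : is_derive z 1 D 0.
  have dN := is_derive_affine F f (-1) 0 z dF.
  by apply: is_derive_eq; rewrite addr0 !mulN1r fN; ring.
have := is_derive0_cst D dD y 0; rewrite /D !(addr0, mulN1r) oppr0 subrr.
by move=> /eqP; rewrite subr_eq0 => /eqP.
Qed.

Lemma odd_primitive {R : realType} (F f : R -> R) : F 0 = 0 ->
  (forall y : R, is_derive y 1 F (f y)) -> (forall y, f (- y) = f y) ->
  forall y, F (- y) = - F y.
Proof.
move=> F0 dF fN y; pose D z := F z + F (-1 * z + 0).
have dD (z : R) : is_derive z 1 D 0.
  have dN := is_derive_affine F f (-1) 0 z dF.
  by apply: is_derive_eq; rewrite addr0 !mulN1r fN; ring.
have := is_derive0_cst D dD y 0; rewrite /D !(addr0, mulN1r) oppr0 F0 addr0.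
by move=> /eqP; rewrite addrC addr_eq0 => /eqP.
Qed.

Lemma cvg_window_integral_ge0 {R : realType} (g : R -> R) (c : R) :
  measurable_fun setT g -> (forall x, 0 <= g x) ->
  (\int[@lebesgue_measure R]_(x in `[(c - n.+1%:R)%R, (c + n.+1%:R)%R])
     (g x)%:E)%E @[n --> \oo]
    --> (\int[@lebesgue_measure R]_x (g x)%:E)%E.
Proof.
move=> mg g0; pose W n := `[c - n.+1%:R, c + n.+1%:R]%classic : set R.
have WT : \bigcup_n W n = setT.
  apply/seteqP; split => // x _; exists (Num.truncn `|x - c|) => //=.
  have : `|x - c| <= (Num.truncn `|x - c|).+1%:R by rewrite ltW// truncnS_gt.
  by rewrite /W /= in_itv/= ler_norml; lra.
have ndW : nondecreasing_seq W.
  apply/nondecreasing_seqP => n; rewrite subsetEset; apply: subset_itv; rewrite bnd_simp.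
    by rewrite lerD2l lerN2 ler_nat.
  by rewrite lerD2l ler_nat.
have mW i : measurable (W i) by exact: measurable_itv.
have mgW i : measurable_fun (W i) (EFin \o g).
  by apply/measurable_EFinP; exact: measurable_funTS.
have gW0 i x : W i x -> (0 <= (EFin \o g) x)%E by rewrite lee_fin.
have := ge0_nondecreasing_set_cvg_integral (mu := @lebesgue_measure R) ndW mW mgW gW0.
by rewrite WT.
Qed.

(** Monotone convergence for the positive and the negative part. *)
Lemma cvg_window_integral {R : realType} (g : R -> R) (c : R) :
  (@lebesgue_measure R).-integrable setT (EFin \o g) ->
  (\int[@lebesgue_measure R]_(x in `[(c - n.+1%:R)%R, (c + n.+1%:R)%R])
     (g x)%:E)%E @[n --> \oo]
    --> (\int[@lebesgue_measure R]_x (g x)%:E)%E.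
Proof.
move=> ig; have mg : measurable_fun setT g.
  by apply/measurable_EFinP; exact: measurable_int ig.
under eq_fun do rewrite integralE funerpos funerneg.
rewrite [X in nbhs X]integralE funerpos funerneg.
apply: cvgeB.
- rewrite fin_num_adde_defl// fin_numN; apply: integrable_fin_num => //.
  exact: integrable_funrneg.
- by apply: cvg_window_integral_ge0 => //; exact: measurable_funrpos.
- by apply: cvg_window_integral_ge0 => //; exact: measurable_funrneg.
Qed.

(** * A density determined by its high frequencies *)

Lemma cos_eq1 {R : realType} (y : R) : 0 < y < 6 * pi -> cos y = 1 ->
  y = 2 * pi \/ y = 4 * pi.
Proof.
move=> /andP[y0 y6] cy.
have s0 : sin (y / 2) = 0.
  have : cos ((y / 2) *+ 2) = 1 by rewrite -mulr_natr divfK// pnatr_eq0.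
  rewrite cos_mulr2n cos2sin2 => e.
  have /eqP : sin (y / 2) ^+ 2 = 0 by rewrite mulr2n in e; lra.
  by rewrite sqrf_eq0 => /eqP.
have sN0 (z : R) : 0 < z < pi -> sin z != 0 by move=> zpi; rewrite gt_eqF// sin_gt0_pi.
have [ypi|ypi|ypi] := ltgtP (y / 2) pi.
- by have /sN0/eqP[] : 0 < y / 2 < pi by lra.
- have [ypi2|ypi2|ypi2] := ltgtP (y / 2) (2 * pi).
  + have /sN0/eqP[] : 0 < y / 2 - pi < pi by lra.
    by rewrite sinB sinpi s0; ring.
  + have /sN0/eqP[] : 0 < y / 2 - pi - pi < pi by lra.
    by rewrite sinB [sin (_ - pi)]sinB sinpi s0; ring.
  + by right; lra.
- by left; lra.
Qed.

(** The frequency 3 sigma of the density exceeds 2 sigma, as needed to move the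
whole of [-sigma, sigma], endpoints included, beyond sigma; and the interval
consists of exactly three of its periods, so that the cosine has integral 0
there. *)
Lemma unique_extension_density {R : realType} (sigma alpha : R) : 0 < sigma ->
  exists phi : R -> R,
    [/\ is_probability_density phi,
        essential_support phi = `[alpha, alpha + 2 * pi / sigma]%classic &
        forall g : R -> R[i], is_characteristic_function g ->
          (forall t, outer_set sigma t -> fun_fourier phi t = g t) ->
          forall t, fun_fourier phi t = g t].
Proof.
move=> sigma0.
have sigmaN0 : sigma != 0 by rewrite gt_eqF.
have [q qE] : exists q : R, q = pi by exists pi.
rewrite -qE; have pi0 : 0 < q by rewrite qE pi_gt0.
have piN0 : q != 0 by rewrite gt_eqF.
set b := alpha + _.
have ab : alpha < b by rewrite ltrDl divr_gt0// mulr_gt0.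
pose p (x : R) : R := sigma / (2 * q) * (1 - cos (3 * sigma * (x - alpha))).
pose P (x : R) : R :=
  sigma / (2 * q) * (x - (3 * sigma)^-1 * sin (3 * sigma * (x - alpha))).
pose phi := p \_ `[alpha, b].
have dP (x : R) : is_derive x 1 P (p x).
  rewrite /P /p; apply: is_derive_eq.
  rewrite !(scaler0, addr0, add0r, subr0, scaler1) /GRing.scale /=.
  by field; rewrite ?piN0 ?sigmaN0.
have cp : continuous p.
  move=> x; apply: cvgM; first exact: cvg_cst.
  apply: cvgB; first exact: cvg_cst.
  by apply: continuous_scaled_shift; exact: continuous_cos.
have c0 : 0 <= sigma / (2 * q) by rewrite divr_ge0 ?mulr_ge0// ltW.
have p0 x : 0 <= p x by rewrite mulr_ge0// subr_ge0 cos_le1.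
have mp : measurable_fun setT p by exact: continuous_measurable_fun.
have phi0 x : 0 <= phi x by rewrite /phi patchE; case: ifP.
have ip := continuous_integrable_itv p alpha b cp.
have iphi : (@lebesgue_measure R).-integrable setT (EFin \o phi).
  rewrite /phi -restrict_EFin; apply/integrable_restrict => //.
  by rewrite setTI.
have mphi : measurable_fun setT phi by apply/measurable_EFinP; exact: measurable_int iphi.
have phi1 : (\int[@lebesgue_measure R]_x (phi x)%:E = 1)%E.
  transitivity (\int[@lebesgue_measure R]_(x in `[alpha, b]) (p x)%:E)%E.
    by rewrite [RHS]integral_mkcond/=; apply: eq_integral => x _; rewrite restrict_EFin.
  rewrite (integral_itvcc_FTC p P alpha b ab cp dP); congr EFin.
  rewrite /P /b subrr mulr0 sin0.
  have -> : 3 * sigma * (alpha + 2 * q / sigma - alpha) = (q *+ 2) *+ 3.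
    by rewrite -mulrnA -[_ *+ _]mulr_natr; field.
  rewrite -(add0r (q *+ 2 *+ 3)) qE (periodicn (@sinD2pi R)) sin0 -qE; field.
  by rewrite ?piN0 ?sigmaN0.
exists phi; split.
- exact: probability_densityP.
- (* the zeros of 1 - cos inside the interval, at one and two thirds of it *)
  pose Z : set R := [set alpha + 2 * q / (3 * sigma); alpha + 4 * q / (3 * sigma)].
  apply: (@essential_support_itvcc _ _ _ _ Z) => //.
  + move=> x xab; rewrite /phi patchE /=; case: ifPn => //.
    by rewrite inE /= (negbTE xab).
  + by apply: finite_set_countable; exact: finite_set2.
  + move=> x xab Zx; rewrite /phi patchE ifT; last first.
      by rewrite inE/=; move: xab; apply: subset_itv_oo_cc.
    rewrite mulf_neq0//; first by rewrite mulf_neq0// invr_eq0 mulf_neq0.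
    rewrite subr_eq0 eq_sym; apply/eqP => c1.
    move: xab; rewrite in_itv/= /b => /andP[ax]; rewrite -ltrBlDl ltr_pdivlMr// => xb.
    have y6 : 0 < 3 * sigma * (x - alpha) < 6 * pi.
      by rewrite -qE !mulr_gt0 ?subr_gt0//=; lra.
    have [e|e] := cos_eq1 _ y6 c1; rewrite -qE in e; apply: Zx => /=; [left|right].
      by rewrite -e; field.
    by rewrite -e; field.
have [nu [nuF nuE]] := density_law phi phi0 iphi phi1.
move=> g [mu muE] gE t; rewrite muE nuF; apply/esym/same_frequencyP; move: t.
have munu : forall s, sigma < `|s| -> same_frequency mu nu s.
  by move=> s ss; apply/same_frequencyP; rewrite -muE -nuF; apply/esym/gE.
apply: (@same_frequency_of_fejer_bound _ mu nu sigma (3 * sigma) alpha 2) => //.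
  by lra.
move=> N.
rewrite nuE; last 2 first.
- exact: measurable_fejer.
- apply: (bounded_by _ _ (N%:R * N%:R)) => x.
  by rewrite ger0_norm ?fejer_ge0 ?fejer_le.
rewrite (_ : 2 = \int[@lebesgue_measure R]_(x in `[alpha, b]) (sigma / q)); last first.
  rewrite Rintegral_cst//= lebesgue_measure_itv/= lte_fin ab -EFinB /= /b.
  by field; rewrite ?piN0 ?sigmaN0.
rewrite (_ : \int[_]_x _ = \int[@lebesgue_measure R]_(x in `[alpha, b])
    (fejer N (3 * sigma * (x - alpha)) * p x)); last first.
  rewrite [RHS]Rintegral_mkcond; apply: eq_Rintegral => x _; rewrite /phi !patchE.
  by case: ifP => //; rewrite mulr0.
have fp x : fejer N (3 * sigma * (x - alpha)) * p x =
    sigma / (2 * q) * (1 - cos (N%:R * (3 * sigma * (x - alpha)))).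
  by rewrite -fejer_mul_one_sub_cos /p; ring.
apply: le_Rintegral => //.
- apply: measurable_bounded_integrable => //.
  + have : (lebesgue_measure (`[alpha, b]%classic : set R) < +oo)%E.
      by rewrite lebesgue_measure_itv/= lte_fin ab -EFinB ltry.
    by [].
  + by apply: measurable_funTS; apply: measurable_funM => //; exact: measurable_fejer.
  + apply: (bounded_by _ _ (sigma / q)) => x; rewrite fp.
    rewrite ger0_norm; last by rewrite mulr_ge0// subr_ge0 cos_le1.
    have := cos_geN1 (N%:R * (3 * sigma * (x - alpha))) => h.
    rewrite (_ : sigma / q = sigma / (2 * q) * 2); last by field.
    by rewrite ler_wpM2l//; lra.
- exact: continuous_integrable_itv (fun x => cvg_cst _).
- move=> x _; rewrite fp.
  have := cos_geN1 (N%:R * (3 * sigma * (x - alpha))) => h.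
  rewrite (_ : sigma / q = sigma / (2 * q) * 2); last by field.
  by rewrite ler_wpM2l//; lra.
Qed.

(** * The sine integral *)

Definition sinc {R : realType} (v : R) : R := if v == 0 then 1 else sin v / v.

(** At 0 the quotient is 0, which is also its limit there: the function is
continuous as it stands. *)
Definition versinc {R : realType} (v : R) : R := (1 - cos v) / v.

Lemma sincE {R : realType} (v : R) : v != 0 -> sinc v = sin v / v.
Proof. by rewrite /sinc => /negbTE ->. Qed.

(** At 0 this is the derivative of the sine. *)
Lemma continuous_sinc {R : realType} : continuous (@sinc R).
Proof.
move=> v; have [->|v0] := eqVneq v 0.
  apply/continuous_withinNx; rewrite [sinc 0]/sinc eqxx.
  have /cvg_ex[l] : derivable (@sin R) 0 1 by exact: derivable_sin.
  move=> /[dup] + /cvg_lim => /[swap] <-//.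
  have -> : lim (h^-1 *: (sin (h *: 1 + 0) - sin 0) @[h --> (0 : R)^'] : set_system R) = 1.
    by have := @derive_val _ _ _ (0 : R) 1 (@sin R) _ (is_derive_sin 0); rewrite cos0.
  apply: cvg_trans; apply: near_eq_cvg; near=> h.
  have h0 : h != 0 by near: h; exact: nbhs_dnbhs_neq.
  rewrite sincE// /GRing.scale/= mulr1 sin0 subr0 addr0.
  by rewrite mulrC.
have c : {for v, continuous (fun x : R => sin x / x)}.
  by apply: cvgM; [exact: continuous_sin|apply: cvgV => //; exact: cvg_id].
rewrite /continuous_at sincE//; apply: cvg_trans c; apply: near_eq_cvg; near=> y.
by rewrite sincE//; near: y; exact: open_neq.
Unshelve. all: by end_near. Qed.

Lemma one_sub_cos {R : realType} (v : R) : 1 - cos v = 2 * sin (v / 2) ^+ 2.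
Proof.
rewrite {1}(_ : v = (v / 2) *+ 2); last by rewrite -mulr_natr divfK ?pnatr_eq0.
by rewrite cos_mulr2n cos2sin2; ring.
Qed.

Lemma half_neq0 {R : realType} (v : R) : v != 0 -> v / 2 != 0.
Proof. by move=> v0; rewrite mulf_neq0// invr_eq0 pnatr_eq0. Qed.

Lemma versincE {R : realType} (v : R) : versinc v = sin (v / 2) * sinc (v / 2).
Proof.
rewrite /versinc; have [->|v0] := eqVneq v 0.
  by rewrite mul0r sin0 mul0r invr0 mulr0.
by rewrite sincE ?half_neq0// one_sub_cos; field.
Qed.

Lemma half_sinc_sqr {R : realType} (v : R) : v != 0 ->
  2^-1 * sinc (v / 2) ^+ 2 = (1 - cos v) / v ^+ 2.
Proof. by move=> v0; rewrite sincE ?half_neq0// one_sub_cos; field. Qed.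

Lemma continuous_versinc {R : realType} : continuous (@versinc R).
Proof.
move=> v; rewrite (_ : @versinc R = fun v => sin (v / 2) * sinc (v / 2)); last first.
  by apply/funext => x; rewrite versincE.
have c2 : {for v, continuous (fun x : R => x / 2)}.
  by apply: cvgM; [exact: cvg_id|exact: cvg_cst].
apply: cvgM.
  apply: (@continuous_comp _ _ _ (fun x : R => x / 2) sin); first exact: c2.
  exact: continuous_sin.
apply: (@continuous_comp _ _ _ (fun x : R => x / 2) sinc); first exact: c2.
exact: continuous_sinc.
Qed.

Lemma versinc0 {R : realType} : versinc 0 = 0 :> R.
Proof. by rewrite /versinc invr0 mulr0. Qed.

Lemma versincN {R : realType} (v : R) : versinc (- v) = - versinc v.
Proof. by rewrite /versinc cosN invrN mulrN. Qed.

Lemma sincN {R : realType} (v : R) : sinc (- v) = sinc v.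
Proof. by rewrite /sinc oppr_eq0 sinN invrN mulrNN. Qed.

Lemma versinc_le {R : realType} (v : R) : 0 < v -> `|versinc v| <= 2 / v.
Proof.
move=> v0; rewrite /versinc normrM normfV (gtr0_norm v0) ler_pM2r ?invr_gt0//.
by rewrite ger0_norm ?subr_ge0 ?cos_le1//; have := cos_geN1 v; lra.
Qed.

Lemma versinc_cvg0 {R : realType} : @versinc R x @[x --> +oo] --> 0.
Proof.
apply/cvgr0Pnorm_le => e e0; near=> x.
have x0 : 0 < x by near: x; exact: nbhs_pinfty_gt.
have ex : 2 / e <= x by near: x; apply: nbhs_pinfty_ge; rewrite num_real.
by apply: (le_trans (versinc_le _ x0)); rewrite ler_pdivrMr// mulrC -ler_pdivrMr.
Unshelve. all: by end_near. Qed.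

Lemma is_derive_versinc {R : realType} (v : R) : v != 0 ->
  is_derive v 1 versinc (sinc v - 2^-1 * sinc (v / 2) ^+ 2).
Proof.
move=> v0; have dV : is_derive v 1 (fun x : R => x^-1) (- v ^- 2).
  by apply: is_derive_eq; [exact: is_deriveV|rewrite [_ *: _]mulr1].
rewrite /versinc; apply: is_derive_eq.
rewrite half_sinc_sqr// sincE// /GRing.scale/=.
by field.
Qed.

(** Integration by parts: S(x) = V(x) + (1 - cos x) / x, where V' is the
nonnegative function (1 - cos v) / v^2. So V is nondecreasing, and it is bounded
because V(x) + 2 / x is nonincreasing for x >= 1; its limit is at least
V(1) > 0. *)
Lemma dirichlet_integral {R : realType} (S : R -> R) : S 0 = 0 ->
  (forall x : R, is_derive x 1 S (sinc x)) ->
  exists2 L : R, 0 < L & S x @[x --> +oo] --> L.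
Proof.
move=> S0 dS; pose kappa (v : R) : R := 2^-1 * sinc (v / 2) ^+ 2.
have ck : continuous kappa.
  move=> v; apply: cvgM; first exact: cvg_cst.
  have c : {for v, continuous (fun x : R => sinc (x / 2))}.
    apply: (@continuous_comp _ _ _ (fun x : R => x / 2) sinc); last exact: continuous_sinc.
    by apply: cvgM; [exact: cvg_id|exact: cvg_cst].
  by apply: cvgM.
have k0 v : 0 <= kappa v by rewrite mulr_ge0// sqr_ge0.
have [V V0 dV] := continuous_has_primitive kappa ck.
have cV := continuous_is_derive _ _ dV.
have ndV : nondecreasing_fun V.
  move=> x y; rewrite le_eqVlt => /predU1P[->//|xy].
  have [z _ e] := MVT xy (fun z _ => dV z) (continuous_subspaceT cV).
  by rewrite -subr_ge0 e mulr_ge0// subr_ge0 ltW.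
have V1 : 0 < V 1.
  have [z] := MVT ltr01 (fun z _ => dV z) (continuous_subspaceT cV).
  rewrite V0 !subr0 mulr1 in_itv/= => /andP[z0 z1] ->.
  have z20 : 0 < z / 2 by rewrite divr_gt0.
  apply: mulr_gt0; first by rewrite invr_gt0.
  apply: exprn_gt0; rewrite sincE ?gt_eqF//; apply: divr_gt0 => //.
  by apply: sin_gt0_pi; have := pi_ge2 R; lra.
have VE x : 0 < x -> S x = V x + versinc x.
  move=> x0; apply/eqP; rewrite -subr_eq0; apply/eqP.
  pose D y := S y - (V y + versinc y).
  have dD z : z \in `]0, x[ -> is_derive z 1 D 0.
    rewrite in_itv/= => /andP[z0 _]; have z0' : z != 0 by rewrite gt_eqF.
    have := is_derive_versinc z z0' => dv.
    by apply: is_derive_eq; rewrite /kappa; ring.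
  have cD : continuous D.
    move=> y; apply: cvgB; first exact: (continuous_is_derive _ _ dS).
    by apply: cvgD; [exact: cV|exact: continuous_versinc].
  have [z _] := MVT x0 dD (continuous_subspaceT cD).
  by rewrite mul0r => <-; rewrite /D S0 V0 versinc0; ring.
have Vub x : V x <= V 1 + 2.
  have [x1|x1] := leP x 1; first by rewrite (le_trans (ndV _ _ x1))// lerDl.
  pose D y := V y + 2 * y^-1.
  have dD z : z \in `]1, x[ -> is_derive z 1 D (kappa z - 2 / z ^+ 2).
    rewrite in_itv/= => /andP[z1 _]; have z0 : z != 0 by rewrite gt_eqF// (lt_trans _ z1).
    have dVz : is_derive z 1 (fun x : R => x^-1) (- z ^- 2).
      by apply: is_derive_eq; [exact: is_deriveV|rewrite [_ *: _]mulr1].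
    by apply: is_derive_eq; rewrite /GRing.scale/=; ring.
  have cD : {within `[1, x], continuous D}.
    apply: continuous_in_subspaceT => y; rewrite inE/= in_itv/= => /andP[y1 _].
    apply: cvgD; first exact: cV.
    apply: cvgM; first exact: cvg_cst.
    by apply: cvgV; [rewrite gt_eqF// (lt_le_trans _ y1)|exact: cvg_id].
  have [z] := MVT x1 dD cD; rewrite in_itv/= => /andP[z1 _] e.
  have z0 : 0 < z by rewrite (lt_trans _ z1).
  have kz : kappa z <= 2 / z ^+ 2.
    rewrite /kappa half_sinc_sqr ?gt_eqF// ler_pM2r ?invr_gt0 ?exprn_gt0//.
    have := cos_geN1 z; lra.
  have x0 : 0 < 2 * x^-1 by rewrite mulr_gt0// invr_gt0 (lt_trans _ x1).
  have : D x - D 1 <= 0 by rewrite e mulr_le0_ge0 ?subr_le0// subr_ge0 ltW.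
  rewrite /D invr1; lra.
have ubV : has_ubound (range V) by exists (V 1 + 2) => _ [x _ <-].
exists (sup (range V)).
  apply: (lt_le_trans V1); apply: ub_le_sup => //; by exists 1.
have cVy := nondecreasing_cvgr ndV ubV.
rewrite -[sup _]addr0; apply: cvg_trans (cvgD cVy versinc_cvg0).
apply: near_eq_cvg; near=> x.
have x0 : 0 < x by near: x; exact: nbhs_pinfty_gt.
by rewrite /= VE.
Unshelve. all: by end_near. Qed.

(** When [S] is the sine integral, this is an antiderivative of
(1 - cos v) / v * sin (s v), by the product-to-sum formulas. *)
Definition trisinc {R : realType} (S : R -> R) (s v : R) : R :=
  S (s * v) - 2^-1 * S ((s + 1) * v) - 2^-1 * S ((s - 1) * v).

Lemma sinc_scale {R : realType} (a v : R) : v != 0 -> a * sinc (a * v) = sin (a * v) / v.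
Proof.
move=> v0; have [->|a0] := eqVneq a 0; first by rewrite !mul0r sin0 mul0r.
by rewrite sincE ?mulf_neq0//; field; rewrite a0 v0.
Qed.

Lemma is_derive_trisinc {R : realType} (S : R -> R) (s v : R) :
  (forall x : R, is_derive x 1 S (sinc x)) ->
  is_derive v 1 (trisinc S s) (versinc v * sin (s * v)).
Proof.
move=> dS; have d a : is_derive v 1 (fun x : R => S (a * x)) (a * sinc (a * v)).
  have := is_derive_affine S sinc a 0 v dS; rewrite addr0.
  by under [X in is_derive _ _ X _]funext do rewrite addr0.
have d0 := d s; have d1 := d (s + 1); have d2 := d (s - 1).
rewrite /trisinc; apply: is_derive_eq; rewrite /GRing.scale/=.
have [->|v0] := eqVneq v 0.
  by rewrite versinc0 !mulr0 [sinc 0]/sinc eqxx; field.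
rewrite !sinc_scale// mulrDl mulrBl mul1r sinD sinB /versinc; field.
exact: v0.
Qed.

Lemma trisincN {R : realType} (S : R -> R) (s v : R) : (forall x, S (- x) = - S x) ->
  trisinc S s (- v) = - trisinc S s v.
Proof. by move=> SN; rewrite /trisinc !mulrN !SN; ring. Qed.

Lemma cvg_shift_pinfty {R : realType} (F : R -> R) (l c : R) :
  F x @[x --> +oo] --> l -> F (x + c) @[x --> +oo] --> l.
Proof.
move=> Fl; apply: (@cvg_comp _ _ _ (fun x => x + c) F _ _ _ _ Fl).
exact: cvg_addrr.
Qed.

Lemma cvg_scale_pinfty {R : realType} (F : R -> R) (l c : R) : 0 < c ->
  F x @[x --> +oo] --> l -> F (c * x) @[x --> +oo] --> l.
Proof.
move=> c0 Fl; apply: (@cvg_comp _ _ _ (fun x => c * x) F _ _ _ _ Fl).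
by apply: gt0_cvgMry.
Qed.

(** The coefficient s - 1 is positive for s > 1 and negative for s = 1/2, so that
the last term tends to - L/2 and to + L/2 respectively, as [S] is odd. *)
Lemma trisinc_cvg {R : realType} (S : R -> R) (L : R) : (forall x, S (- x) = - S x) ->
  S x @[x --> +oo] --> L ->
  [/\ trisinc S 0 x @[x --> +oo] --> 0,
      forall s, 1 < `|s| -> trisinc S s x @[x --> +oo] --> 0 &
      trisinc S 2^-1 x @[x --> +oo] --> L].
Proof.
move=> SN SL.
have S0 : S 0 = 0 by have := SN 0; rewrite oppr0; lra.
have far s : 1 < s -> trisinc S s x @[x --> +oo] --> 0.
  move=> s1; have -> : 0 = L - 2^-1 * L - 2^-1 * L by field.
  apply: cvgB; first apply: cvgB.
  - by apply: cvg_scale_pinfty => //; lra.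
  - by apply: cvgM; [exact: cvg_cst|apply: cvg_scale_pinfty => //; lra].
  - by apply: cvgM; [exact: cvg_cst|apply: cvg_scale_pinfty => //; lra].
split.
- have -> : trisinc S 0 = cst 0; last exact: cvg_cst.
  apply/funext => x; rewrite /trisinc /= !(mul0r, add0r, sub0r, mul1r, mulN1r).
  by rewrite SN S0; ring.
- move=> s; have [s0|s0] := leP 0 s; first by rewrite ger0_norm//; exact: far.
  rewrite ltr0_norm// => /far; rewrite -[X in _ --> X]oppr0 => /cvgN.
  rewrite (_ : - _ = trisinc S s)// ?oppr0//.
  apply/funext => x; rewrite /trisinc /= opprfctE.
  have -> : (- s + 1) * x = - ((s - 1) * x) by ring.
  have -> : (- s - 1) * x = - ((s + 1) * x) by ring.
  by rewrite mulNr !SN; ring.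
- have -> : trisinc S 2^-1 =
      fun x => S (2^-1 * x) - 2^-1 * S ((2^-1 + 1) * x) + 2^-1 * S (2^-1 * x).
    apply/funext => x; rewrite /trisinc.
    rewrite (_ : (2^-1 - 1) * x = - (2^-1 * x)); last by field.
    by rewrite SN; ring.
  have LE : L = L - 2^-1 * L + 2^-1 * L by field.
  rewrite [X in _ --> X]LE.
  apply: cvgD; first apply: cvgB.
  - by apply: cvg_scale_pinfty => //; lra.
  - by apply: cvgM; [exact: cvg_cst|apply: cvg_scale_pinfty => //; lra].
  - by apply: cvgM; [exact: cvg_cst|apply: cvg_scale_pinfty => //; lra].
Qed.

(** * The extremal function and its transform *)

(** The continuous extension of (1 + cos u) / (u^2 - pi^2), by partial fractions
and 1 + cos u = 1 - cos (u -+ pi). *)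
Definition extremal {R : realType} (u : R) : R :=
  (versinc (u - pi) - versinc (u + pi)) / (2 * pi).

Lemma extremalE {R : realType} (u : R) : u != pi -> u != - pi ->
  extremal u = (1 + cos u) / (u ^+ 2 - pi ^+ 2).
Proof.
move=> u1 u2; rewrite /extremal /versinc cosB cosD cospi sinpi.
have := pi_gt0 R; move: (pi : R) u1 u2 => q u1 u2 q0.
have d1 : u - q != 0 by rewrite subr_eq0.
have d2 : u + q != 0 by rewrite addr_eq0.
have -> : u ^+ 2 - q ^+ 2 = (u - q) * (u + q) by ring.
by field; rewrite d1 d2 gt_eqF.
Qed.

Lemma extremalN {R : realType} (u : R) : extremal (- u) = extremal u.
Proof.
rewrite /extremal (_ : - u - pi = - (u + pi)); last by ring.
rewrite (_ : - u + pi = - (u - pi)); last by ring.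
by rewrite !versincN opprK addrC.
Qed.

Lemma extremal_pi {R : realType} : extremal pi = 0 :> R.
Proof.
rewrite /extremal subrr versinc0 /versinc (_ : pi + pi = pi *+ 2)// cos2pi.
by rewrite subrr mul0r subrr mul0r.
Qed.

Lemma extremal_ge0 {R : realType} (u : R) : pi <= `|u| -> 0 <= extremal u.
Proof.
move=> piu; have [->|u1] := eqVneq u pi; first by rewrite extremal_pi.
have [->|u2] := eqVneq u (- pi); first by rewrite extremalN extremal_pi.
rewrite extremalE//; apply: divr_ge0; first by have := cos_geN1 u; lra.
by rewrite subr_ge0 -(real_normK (num_real u)) ler_pXn2r// ?nnegrE ?pi_ge0.
Qed.

Lemma extremal_lt0 {R : realType} (u : R) : `|u| < pi -> extremal u < 0.
Proof.
move=> upi; rewrite extremalE; last 2 first.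
- by apply: contraTneq upi => ->; rewrite ger0_norm ?pi_ge0// ltxx.
- by apply: contraTneq upi => ->; rewrite normrN ger0_norm ?pi_ge0// ltxx.
rewrite pmulr_rlt0 ?invr_lt0.
  by rewrite subr_lt0 -(real_normK (num_real u)) ltr_pXn2r// ?nnegrE ?pi_ge0.
rewrite -(cos_norm u) -ltrBlDl sub0r -cospi ltr_cos// in_itv/= ?normr_ge0 ?pi_ge0/=.
  exact: ltW.
exact: lexx.
Qed.

Lemma continuous_extremal {R : realType} : continuous (@extremal R).
Proof.
have sh c : continuous (fun u : R => versinc (u + c)).
  move=> u; apply: (@continuous_comp _ _ _ (fun u : R => u + c) versinc).
    by apply: cvgD; [exact: cvg_id|exact: cvg_cst].
  exact: continuous_versinc.
move=> u; apply: cvgM; last exact: cvg_cst.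
by apply: cvgB; exact: sh.
Qed.

(** Substituting u = v + pi and u = v - pi in the two translates and expanding
cos (s u), the antiderivative splits into cos (s pi) times G(u - pi) - G(u + pi),
where G' = versinc v * cos (s v), and - sin (s pi) times the sum of the values of
[trisinc S s] at u - pi and u + pi. The first part tends to 0 by the mean value
theorem, although G need not be bounded (as for s = 0). *)
Lemma primitive_extremal_cos {R : realType} (S : R -> R) (s l : R) : S 0 = 0 ->
  (forall x : R, is_derive x 1 S (sinc x)) ->
  trisinc S s x @[x --> +oo] --> l ->
  exists F : R -> R, [/\ forall u : R, is_derive u 1 F (extremal u * cos (s * u)),
    forall u, F (- u) = - F u &
    F x @[x --> +oo] --> - (sin (s * pi) * l / pi)].
Proof.
move=> S0 dS Zl.
have [q qE] : exists q : R, q = pi by exists pi.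
have q0 : 0 < q by rewrite qE pi_gt0.
have qN0 : q != 0 by rewrite gt_eqF.
have cg : continuous (fun v : R => versinc v * cos (s * v)).
  move=> v; apply: cvgM; first exact: continuous_versinc.
  have := @continuous_wave R s 0 v; rewrite /wave /continuous_at addr0.
  by under [X in X @ _ --> _ -> _]eq_fun do rewrite addr0.
have [G G0 dG] := continuous_has_primitive _ cg.
have GN : forall y, G (- y) = G y.
  by apply: (even_primitive _ _ dG) => y; rewrite versincN mulrN cosN mulNr.
have SN : forall y, S (- y) = - S y.
  by apply: (odd_primitive _ _ S0 dS) => y; rewrite sincN.
have ZN v := trisincN S s v SN.
have dZ v := is_derive_trisinc S s v dS.
pose F u := (2 * q)^-1 * (cos (s * q) * (G (u - q) - G (u + q)) -
  sin (s * q) * (trisinc S s (u - q) + trisinc S s (u + q))).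
exists F; rewrite /extremal -qE; split.
- move=> u.
  have sh (H h : R -> R) c : (forall v : R, is_derive v 1 H (h v)) ->
      is_derive u 1 (fun x : R => H (x + c)) (h (u + c)).
    move=> dH; have := is_derive_affine H h 1 c u dH; rewrite !mul1r.
    by under [X in is_derive _ _ X _]funext do rewrite mul1r.
  have d1 := sh _ _ (- q) dG; have d2 := sh _ _ q dG.
  have d3 := sh _ _ (- q) dZ; have d4 := sh _ _ q dZ.
  rewrite /F; apply: is_derive_eq; rewrite /GRing.scale/=.
  have -> : s * (u - q) = s * u - s * q by ring.
  have -> : s * (u + q) = s * u + s * q by ring.
  rewrite !(cosD, sinD, cosN, sinN).
  have cs : cos (s * q) ^+ 2 = 1 - sin (s * q) ^+ 2.
    by rewrite -(cos2Dsin2 (s * q)); ring.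
  move: (cos (s * q)) (sin (s * q)) cs => c t cs.
  move: (cos (s * u)) (sin (s * u)) (versinc (u - q)) (versinc (u + q)) => c' t' w w'.
  transitivity ((2 * q)^-1 * ((c ^+ 2 + t ^+ 2) * c' * (w - w'))); first by ring.
  by rewrite cs subrK; ring.
- move=> u; rewrite /F.
  have -> : - u - q = - (u + q) by ring.
  have -> : - u + q = - (u - q) by ring.
  by rewrite !GN !ZN; ring.
rewrite /F.
have -> : - (sin (s * q) * l / q) =
    (2 * q)^-1 * (cos (s * q) * 0 - sin (s * q) * (l + l)) by field.
apply: cvgM; first exact: cvg_cst.
apply: cvgB; apply: cvgM; first exact: cvg_cst; last 2 first.
- exact: cvg_cst.
- by apply: cvgD; exact: cvg_shift_pinfty.
apply/cvgr0Pnorm_le => e e0; near=> x.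
have x0 : 0 < x - q by rewrite subr_gt0; near: x; apply: nbhs_pinfty_gt; rewrite num_real.
(* mean value theorem: |G(x - q) - G(x + q)| <= 2 / z * (2 q) for some z > x - q *)
have xe : 4 * q / e <= x - q.
  by rewrite lerBrDr; near: x; apply: nbhs_pinfty_ge; rewrite num_real.
have xq : x - q < x + q by lra.
have [z] := MVT xq (fun z _ => dG z) (continuous_subspaceT (continuous_is_derive _ _ dG)).
rewrite in_itv/= => /andP[xz _] Ge.
have z0 : 0 < z by rewrite (lt_trans _ xz).
rewrite distrC Ge normrM (_ : x + q - (x - q) = 2 * q); last by ring.
rewrite [`|2 * q|]gtr0_norm ?mulr_gt0// normrM.
have h1 : `|versinc z| * `|cos (s * z)| <= 2 / z.
  rewrite (le_trans _ (versinc_le _ z0))// ler_piMr// cos_max//.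
have h2 : 2 / z * (2 * q) <= e.
  rewrite (_ : 2 / z * (2 * q) = 4 * q / z); last by ring.
  rewrite ler_pdivrMr//.
  have : 4 * q / e <= z by rewrite (le_trans xe) ?ltW.
  rewrite ler_pdivrMr//; lra.
by apply: le_trans h2; rewrite ler_wpM2r// mulr_ge0// ltW.
Unshelve. all: by end_near. Qed.

(** On windows centered at [c] only the even part cos (t (x - c)) of the wave
contributes, because the antiderivative of an odd function is even. *)
Lemma integral_window_extremal {R : realType} (S : R -> R) (sigma c t theta l : R) :
  0 < sigma -> S 0 = 0 -> (forall x : R, is_derive x 1 S (sinc x)) ->
  trisinc S (t / sigma) x @[x --> +oo] --> l ->
  (\int[@lebesgue_measure R]_(x in `[(c - n.+1%:R)%R, (c + n.+1%:R)%R])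
     (extremal (sigma * (x - c)) * wave t theta x)%:E)%E @[n --> \oo]
    --> (- (2 / (sigma * pi) * cos (t * c + theta) * sin (t / sigma * pi) * l))%:E.
Proof.
move=> sigma0 S0 dS Zl; have sigmaN0 : sigma != 0 by rewrite gt_eqF.
have [F [dF FN Fl]] := primitive_extremal_cos S (t / sigma) l S0 dS Zl.
have ce : continuous (fun u : R => extremal u * sin (t / sigma * u)).
  move=> u; apply: cvgM; first exact: continuous_extremal.
  apply: (@continuous_comp _ _ _ (fun u : R => t / sigma * u) sin).
    by apply: cvgM; [exact: cvg_cst|exact: cvg_id].
  exact: continuous_sin.
have [E _ dE] := continuous_has_primitive _ ce.
have EN : forall y, E (- y) = E y.
  by apply: (even_primitive _ _ dE) => y; rewrite extremalN mulrN sinN mulrN.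
pose a := t * c + theta.
pose H (x : R) : R := sigma^-1 *
  (cos a * F (sigma * x + - (sigma * c)) - sin a * E (sigma * x + - (sigma * c))).
have dH (x : R) : is_derive x 1 H (extremal (sigma * (x - c)) * wave t theta x).
  have d1 := is_derive_affine F _ sigma (- (sigma * c)) x dF.
  have d2 := is_derive_affine E _ sigma (- (sigma * c)) x dE.
  apply: is_derive_eq; rewrite /GRing.scale/=.
  have -> : sigma * x - sigma * c = sigma * (x - c) by ring.
  have -> : wave t theta x = cos (t / sigma * (sigma * (x - c)) + a).
    by rewrite /wave; congr cos; rewrite /a; field.
  rewrite (cosD (t / sigma * (sigma * (x - c)))); field; exact: sigmaN0.
have cf : continuous (fun x : R => extremal (sigma * (x - c)) * wave t theta x).
  move=> x; apply: cvgM; last exact: continuous_wave.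
  by apply: continuous_scaled_shift; exact: continuous_extremal.
have HE (n : nat) : (\int[@lebesgue_measure R]_(x in `[(c - n.+1%:R)%R, (c + n.+1%:R)%R])
     (extremal (sigma * (x - c)) * wave t theta x)%:E)%E =
     (2 / sigma * cos a * F (sigma * n.+1%:R))%:E.
  rewrite (integral_itvcc_FTC _ H)//; last by rewrite ltrD2l gtrN// ltr0n.
  rewrite /H; congr EFin.
  have -> : sigma * (c + n.+1%:R) - sigma * c = sigma * n.+1%:R by ring.
  have -> : sigma * (c - n.+1%:R) - sigma * c = - (sigma * n.+1%:R) by ring.
  by rewrite FN EN; field.
under eq_fun do rewrite HE.
apply/fine_cvgP; split; first by near=> n.
rewrite /comp/=.
have [q qE] : exists q : R, q = pi by exists pi.
rewrite -qE in Fl *; have qN0 : q != 0 by rewrite qE gt_eqF// pi_gt0.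
have -> : - (2 / (sigma * q) * cos (t * c + theta) * sin (t / sigma * q) * l) =
   2 / sigma * cos a * - (sin (t / sigma * q) * l / q).
  by rewrite /a; field; rewrite qN0 sigmaN0.
apply: cvgM; first exact: cvg_cst.
apply: (@cvg_comp _ _ _ (fun n : nat => n.+1%:R : R) (fun x => F (sigma * x)) _ _ _ _
  (cvg_scale_pinfty F _ sigma sigma0 Fl)).
by have := @cvgr_idn R; rewrite -cvg_shiftS.
Unshelve. all: by end_near. Qed.

(** * A density not determined by its high frequencies *)

Section extremal_parts.
Context {R : realType} (sigma alpha : R) (sigma_gt0 : 0 < sigma).
Local Notation leb := (@lebesgue_measure R).

Let c := alpha + pi / sigma.
Let b := alpha + 2 * pi / sigma.
Let f (x : R) : R := extremal (sigma * (x - c)).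

Let cf : continuous f.
Proof. by apply: continuous_scaled_shift; exact: continuous_extremal. Qed.

Let mf : measurable_fun setT f.
Proof. exact: continuous_measurable_fun. Qed.

Let ab : alpha < b.
Proof. by rewrite ltrDl divr_gt0// mulr_gt0// pi_gt0. Qed.

Let inside x : (`|sigma * (x - c)| < pi) = (x \in `]alpha, b[).
Proof.
rewrite normrM (gtr0_norm sigma_gt0) mulrC -ltr_pdivlMr// in_itv/= ltr_norml.
rewrite /c /b; have -> : 2 * pi / sigma = pi / sigma + pi / sigma by ring.
by apply/idP/idP; lra.
Qed.

Let f_lt0 x : x \in `]alpha, b[ -> f x < 0.
Proof. by rewrite -inside; exact: extremal_lt0. Qed.

Let f_ge0 x : x \notin `]alpha, b[ -> 0 <= f x.
Proof. by rewrite -inside -leNgt; exact: extremal_ge0. Qed.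

Let f_end x : x \in `[alpha, b] -> f x <= 0.
Proof.
move=> xab; have [/f_lt0/ltW//|xN] := boolP (x \in `]alpha, b[).
have : x = alpha \/ x = b.
  move: xab xN; rewrite !in_itv/= negb_and -!leNgt => /andP[? ?].
  by move=> /orP[?|?]; [left|right]; lra.
have sN0 : sigma != 0 by rewrite gt_eqF.
have e : sigma * (pi / sigma) = pi by rewrite mulrC divfK.
move=> [->|->]; rewrite /f /c /b.
  have -> : sigma * (alpha - (alpha + pi / sigma)) = - (sigma * (pi / sigma)) by ring.
  by rewrite e extremalN extremal_pi.
have -> : sigma * (alpha + 2 * pi / sigma - (alpha + pi / sigma)) =
  sigma * (pi / sigma) by ring.
by rewrite e extremal_pi.
Qed.

Let f_split x : f x = f^\+ x - f^\- x.
Proof.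
rewrite /numfun.funrpos /numfun.funrneg; have [y0|/ltW y0] := leP (f x) 0.
  by have /max_idPl -> : 0 <= - f x; rewrite ?oppr_ge0// sub0r opprK.
by have /max_idPr -> : - f x <= 0; rewrite ?oppr_le0// subr0.
Qed.

(** [f] is negative exactly inside the interval, and vanishes at its ends. *)
Let fneg : f^\- = (fun x => - f x) \_ `[alpha, b].
Proof.
apply/funext => x; rewrite patchE /= /numfun.funrneg; case: ifPn => xab.
  by apply/max_idPl; rewrite oppr_ge0 f_end//; move: xab; rewrite inE.
apply/max_idPr; rewrite oppr_le0 f_ge0//; apply: contraNN xab => xab.
by rewrite inE/=; apply: subset_itv_oo_cc.
Qed.

Let integrable_fneg : leb.-integrable setT (EFin \o f^\-).
Proof.
rewrite fneg -restrict_EFin; apply/integrable_restrict => //.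
rewrite setTI; apply: continuous_integrable_itv => x.
by apply: cvgN; exact: cf.
Qed.

Let integral_fneg : exists2 N : R, 0 < N & (\int[leb]_x (f^\- x)%:E = N%:E)%E.
Proof.
have cNf : continuous (fun x => - f x) by move=> x; apply: cvgN; exact: cf.
have [F _ dF] := continuous_has_primitive _ cNf.
exists (F b - F alpha).
  have [z zab ->] := MVT ab (fun z _ => dF z) (continuous_subspaceT (continuous_is_derive _ _ dF)).
  by rewrite mulr_gt0 ?subr_gt0// oppr_gt0 f_lt0.
rewrite -(integral_itvcc_FTC _ F _ _ ab cNf dF) [RHS]integral_mkcond.
by apply: eq_integral => x _; rewrite fneg restrict_EFin.
Qed.

(** The three cases are those in which the limit of [trisinc] at s = t / sigma,
which is a factor of the transform of [f], is known: it is 0, 0 and L. *)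
Let transform_limits : exists2 L : R, 0 < L & forall t theta l,
  [\/ t = 0 /\ l = 0, sigma < `|t| /\ l = 0 | t = sigma / 2 /\ l = L] ->
  (\int[leb]_(x in `[(c - n.+1%:R)%R, (c + n.+1%:R)%R])
     (f x * wave t theta x)%:E)%E @[n --> \oo]
    --> (- (2 / (sigma * pi) * cos (t * c + theta) * sin (t / sigma * pi) * l))%:E.
Proof.
have [S S0 dS] := continuous_has_primitive _ (@continuous_sinc R).
have SN : forall y, S (- y) = - S y.
  by apply: (odd_primitive _ _ S0 dS) => y; rewrite sincN.
have [L L0 SL] := dirichlet_integral S S0 dS.
have [T0 T1 T2] := trisinc_cvg S L SN SL.
exists L => // t theta l h; apply: (integral_window_extremal S) => //.
case: h => -[h ->].
- by rewrite h mul0r.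
- by apply: T1; rewrite normrM normfV (gtr0_norm sigma_gt0) ltr_pdivlMr// mul1r.
- by rewrite h mulrAC divff ?gt_eqF// mul1r.
Qed.

(** Integrability of [f] is not known at this point. But its integrals over
large windows tend to 0, the transform limit at the frequency 0, and those of
[f^\-] and [f^\+] converge monotonically. *)
Let integral_fpos : (\int[leb]_x (f^\+ x)%:E = \int[leb]_x (f^\- x)%:E)%E.
Proof.
have [L _ /(_ 0 0 0)] := transform_limits.
rewrite mulr0 oppr0 => /(_ (Or31 _ _ (conj erefl erefl))) lim0.
have limN := cvg_window_integral f^\- c integrable_fneg.
have limP : (\int[leb]_(x in `[(c - n.+1%:R)%R, (c + n.+1%:R)%R])
    (f^\+ x)%:E)%E @[n --> \oo]
    --> (\int[leb]_x (f^\+ x)%:E)%E.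
  apply: cvg_window_integral_ge0; first exact: measurable_funrpos.
  by move=> x; exact: funrpos_ge0.
have [N N0 NE] := integral_fneg.
have := cvgeD _ lim0 limN; rewrite NE add0e => /(_ _ isT) limD.
apply: (cvg_unique _ limP) => //.
apply: cvg_trans limD; apply: near_eq_cvg; near=> n.
have iW (g : R -> R) : continuous g ->
    leb.-integrable `[(c - n.+1%:R)%R, (c + n.+1%:R)%R] (EFin \o g).
  exact: continuous_integrable_itv.
rewrite -integralD_EFin//=.
- apply: eq_integral => x _; rewrite /wave mul0r addr0 cos0 mulr1 -EFinD; congr EFin.
  by rewrite [X in X + _]f_split subrK.
- have cfw : continuous (fun x => f x * wave 0 0 x).
    by move=> x; apply: cvgM; [exact: cf|exact: continuous_wave].
  exact: (iW _ cfw).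
- by apply: integrableS integrable_fneg => //.
Unshelve. all: by end_near. Qed.

Lemma nonunique_extension_density :
  exists (phi : R -> R) (g : R -> R[i]),
    [/\ is_probability_density phi,
        essential_support phi = `[alpha, b]%classic,
        is_characteristic_function g,
        (forall t, outer_set sigma t -> fun_fourier phi t = g t) &
        ~ (forall t, fun_fourier phi t = g t)].
Proof.
have [N N0 negE] := integral_fneg.
have posE : (\int[leb]_x (f^\+ x)%:E = N%:E)%E by rewrite integral_fpos.
have integrable_fpos : leb.-integrable setT (EFin \o f^\+).
  apply/integrableP; split; first by apply/measurable_EFinP; exact: measurable_funrpos.
  under eq_integral do rewrite /= ger0_norm ?funrpos_ge0//.
  by rewrite posE ltry.
have integrable_f : leb.-integrable setT (EFin \o f).
  rewrite (_ : EFin \o f = fun x => ((f^\+ x)%:E - (f^\- x)%:E)%E).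
    exact: integrableB.
  by apply/funext => x; rewrite /= -EFinB -f_split.
have norm1 (g : R -> R) : leb.-integrable setT (EFin \o g) ->
    (\int[leb]_x (g x)%:E = N%:E)%E -> (\int[leb]_x (N^-1 * g x)%:E = 1)%E.
  move=> ig gN; under eq_integral do rewrite EFinM.
  by rewrite integralZl// gN -EFinM mulVf// gt_eqF.
have normi (g : R -> R) : leb.-integrable setT (EFin \o g) ->
    leb.-integrable setT (EFin \o (fun x => N^-1 * g x)).
  by move=> ig; apply: (integrableZl _ (N^-1) ig).
pose p x := N^-1 * f^\+ x; pose phi x := N^-1 * f^\- x.
have p0 x : 0 <= p x by rewrite mulr_ge0 ?invr_ge0 ?funrpos_ge0// ltW.
have phi0 x : 0 <= phi x by rewrite mulr_ge0 ?invr_ge0 ?funrneg_ge0// ltW.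
have ip := normi _ integrable_fpos; have iphi := normi _ integrable_fneg.
have p1 := norm1 _ integrable_fpos posE; have phi1 := norm1 _ integrable_fneg negE.
have [mu [_ muE]] := density_law p p0 ip p1.
have [nu [nuF nuE]] := density_law phi phi0 iphi phi1.
have diffE t theta : \int[mu]_x wave t theta x - \int[nu]_x wave t theta x =
    N^-1 * \int[leb]_x (f x * wave t theta x).
  have iw g := integrable_mul_wave g t theta.
  rewrite muE ?nuE; [|exact: measurable_wave|exact: bounded_wave
    |exact: measurable_wave|exact: bounded_wave].
  rewrite -RintegralZl//; last exact: iw.
  under [X in X - _]eq_Rintegral do rewrite mulrC.
  under [X in _ - X]eq_Rintegral do rewrite mulrC.
  rewrite -RintegralB//; [|exact: iw|exact: iw].
  apply: eq_Rintegral => x _; rewrite /p /phi -mulrBl -mulrBr mulrA; congr (_ * _ * _).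
  by rewrite -f_split.
have [L L0 lims] := transform_limits.
have fE t theta l :
    [\/ t = 0 /\ l = 0, sigma < `|t| /\ l = 0 | t = sigma / 2 /\ l = L] ->
    \int[leb]_x (f x * wave t theta x) =
    - (2 / (sigma * pi) * cos (t * c + theta) * sin (t / sigma * pi) * l).
  move=> /(lims t theta); rewrite /Rintegral.
  have := cvg_window_integral _ c (integrable_mul_wave _ t theta integrable_f).
  by move=> /cvg_unique/[apply] ->.
exists phi, (measure_fourier mu); split.
- exact: probability_densityP.
- apply: (@essential_support_itvcc _ _ _ _ set0) => //.
  + by apply/measurable_EFinP; exact: measurable_int iphi.
  + move=> x xab; rewrite /phi fneg patchE ifF ?mulr0//.
    by apply/negbTE; rewrite notin_setE/=; exact/negP.
  + move=> x xab _; rewrite /phi fneg patchE ifT; last first.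
      by rewrite inE/=; apply: subset_itv_oo_cc.
    by apply: mulf_neq0; [rewrite invr_eq0 gt_eqF|rewrite oppr_eq0 lt_eqF// f_lt0].
- by exists mu.
- move=> t st; rewrite nuF; apply/same_frequencyP => theta.
  apply/esym/eqP; rewrite -subr_eq0 diffE (fE t theta 0).
    by rewrite mulr0 oppr0 mulr0.
  exact: Or32.
- (* the phase makes the cosine factor of the transform of f equal to 1 *)
  move=> /(_ (sigma / 2)); rewrite nuF => /same_frequencyP /(_ (- (sigma / 2 * c))) e.
  have := diffE (sigma / 2) (- (sigma / 2 * c)); rewrite e subrr.
  rewrite (fE _ _ L); last exact: Or33.
  have -> : sigma / 2 / sigma * pi = pi / 2.
    by rewrite (mulrAC sigma) divff ?gt_eqF// mul1r mulrC.
  rewrite subrr cos0 sin_pihalf !mulr1 => /esym/eqP.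
  by rewrite mulrN oppr_eq0 gt_eqF// !(mulr_gt0, divr_gt0, invr_gt0, pi_gt0).
Qed.

End extremal_parts.

(** * Both cases occur *)

Theorem proposition1p8 (R : realType) (sigma alpha : R) (sigma_gt0 : 0 < sigma) :
  (exists phi : R -> R,
    [/\ is_probability_density phi,
        essential_support phi = `[alpha, alpha + 2 * pi / sigma]%classic &
        forall g : R -> R[i], is_characteristic_function g ->
          (forall t, outer_set sigma t -> fun_fourier phi t = g t) ->
          forall t, fun_fourier phi t = g t])
  /\
  (exists (phi : R -> R) (g : R -> R[i]),
    [/\ is_probability_density phi,
        essential_support phi = `[alpha, alpha + 2 * pi / sigma]%classic,
        is_characteristic_function g,
        (forall t, outer_set sigma t -> fun_fourier phi t = g t) &
        ~ (forall t, fun_fourier phi t = g t)]).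
Proof.
split; first exact: unique_extension_density.
exact: nonunique_extension_density.
Qed.
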